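(* Let $w$ be a positive even integer and $n$ a positive integer. The Hecke operator $T_n^{\infty}$ on $\mathcal{Q}_{\mathcal{E},-w}$ is compatible with the Hecke operator $T_n$ on $S_{w+2}$: for every $f\in S_{w+2}$, $$Q_{w+2}(T_nf)=T_n^{\infty}(Q_{w+2}(f)).$$
   Context: $S_{w+2}$ is the space of cusp forms of weight $w+2$ on $\mathrm{SL}_2(\mathbb{Z})$, with the usual Hecke operator $(T_nf)(z)=n^{w+1}\sum_{ad=n,\,d>0}d^{-(w+2)}\sum_{b=0}^{d-1}f\left(\frac{az+b}{d}\right)$. A Dedekind symbol of weight $w$ is a function $E:\mathbb{Z}^{+}\times\mathbb{Z}\to\mathbb{C}$ with $E(h,k+h)=E(h,k)$ and $E(ch,ck)=c^{w}E(h,k)$ for all $c\in\mathbb{Z}^{+}$. $\mathcal{E}_w$ is the space of Dedekind symbols $E$ of weight $w$ for which $E(h,k)-E(k,-h)$ is (for $h,k\in\mathbb{Z}^{+}$) given by a homogeneous polynomial of degree $w$ in $h,k$ with complex coefficients. The map $\Psi_w$ sends $E\in\mathcal{E}_w$ to the function $\Psi_w(E):\mathbb{Q}\to\mathbb{C}$, $\Psi_w(E)(k/h)=h^{-w}E(h,k)$ ($h\in\mathbb{Z}^{+}$, $k\in\mathbb{Z}$), and $\mathcal{Q}_{\mathcal{E},-w}=\Psi_w(\mathcal{E}_w)$. The map $\alpha_{w+2}:S_{w+2}\to\mathcal{E}_w$ sends $f$ to $E_f(h,k)=\int_{k/h}^{i\infty}f(z)(hz-k)^{w}\,dz$, and $Q_{w+2}=\Psi_w\circ\alpha_{w+2}:S_{w+2}\to\mathcal{Q}_{\mathcal{E},-w}$.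 The Hecke operator on $\mathcal{Q}_{\mathcal{E},-w}$ is $$(T_n^{\infty}\widetilde f)(x)=\sum_{ad=n,\ d>0}d^{w}\sum_{b=0}^{d-1}\widetilde f\left(\frac{ax+b}{d}\right)\qquad(x\in\mathbb{Q}).$$ *)

(* Defs.v *)
From HB Require Import structures.
From mathcomp Require Import all_boot all_order all_algebra.
From mathcomp Require Import complex.
From mathcomp Require Import all_classical all_reals all_analysis.

Set Implicit Arguments.
Unset Strict Implicit.
Unset Printing Implicit Defensive.

Import Order.TTheory GRing.Theory Num.Theory.
Import numFieldNormedType.Exports.

Local Open Scope classical_set_scope.
Local Open Scope ring_scope.
Local Open Scope complex_scope.

Section Defs.
Context {R : realType}.

(* The norm topology on C, with C a normed module over itself; for
   functions on it, [derivable _ z 1] is complex differentiability at z. *)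
Local Notation C := (R[i]^o).
Local Notation Re := complex.Re.
Local Notation Im := complex.Im.

Definition cexp (z : C) : C :=
  (expR (Re z) * cos (Im z)) +i* (expR (Re z) * sin (Im z)).

(* A function on the upper half-plane is represented by a function on C
   whose values outside the half-plane are irrelevant. *)
Definition upper_half : set C := [set z : C | 0 < Im z].

Definition qparam (z : C) : C := cexp (2 * pi%:C * 'i%C * z).

(* Cusp forms of weight [wt] on SL_2(Z); the condition at the cusp is that
   the q-expansion has no terms of exponent <= 0. *)
Definition cusp_form (wt : nat) : set (C -> C) := [set f |
  [/\ (forall z, upper_half z -> derivable f z 1),
      (forall (a b c d : int) (z : C), a * d - b * c = 1 -> upper_half z ->
         f ((a%:~R * z + b%:~R) / (c%:~R * z + d%:~R))
         = (c%:~R * z + d%:~R) ^+ wt * f z)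
    & exists2 a : nat -> C, a 0%N = 0 &
        forall z, upper_half z ->
          (fun N => \sum_(0 <= m < N) a m * qparam z ^+ m) @ \oo --> f z]].

(* T_n on weight w+2; for n > 0, a = n / d. *)
Definition hecke (w n : nat) (f : C -> C) (z : C) : C :=
  n%:R ^+ w.+1 *
  \sum_(d <- divisors n) d%:R ^- (w + 2) *
    \sum_(b < d) f (((n %/ d)%:R * z + b%:R) / d%:R).

(* Dedekind symbols are functions on Z x Z, of which only the values at
   (h, k) with h > 0 are meaningful. *)
Definition dedekind_symbol (w : nat) (E : int -> int -> C) : Prop :=
  (forall h k : int, 0 < h -> E h (k + h) = E h k) /\
  (forall c h k : int, 0 < c -> 0 < h ->
     E (c * h) (c * k) = c%:~R ^+ w * E h k).

(* The space E_w. *)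
Definition dedekind_space (w : nat) : set (int -> int -> C) := [set E |
  dedekind_symbol w E /\
  exists p : nat -> C, forall h k : int, 0 < h -> 0 < k ->
    E h k - E k (- h) = \sum_(j < w.+1) p j * h%:~R ^+ j * k%:~R ^+ (w - j)].

(* Evaluated on the reduced fraction of x; see [Psi_frac]. *)
Definition Psi (w : nat) (E : int -> int -> C) (x : rat) : C :=
  (denq x)%:~R ^- w * E (denq x) (numq x).

(* The space Q_{E,-w}. *)
Definition quantum_space (w : nat) : set (rat -> C) :=
  Psi w @` dedekind_space w.

Definition Cintegral (D : set R) (g : R -> C) : C :=
  (\int[lebesgue_measure]_(t in D) Re (g t)) +i*
  (\int[lebesgue_measure]_(t in D) Im (g t)).

(* Contour integral of g from the real point x to i oo, along z = x + i t,
   0 < t < +oo, dz = i dt, as a Lebesgue integral. *)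
Definition vertical_integral (x : R) (g : C -> C) : C :=
  Cintegral `]0, +oo[ (fun t => g (x +i* t) * 'i%C).

Definition alpha (w : nat) (f : C -> C) (h k : int) : C :=
  vertical_integral (k%:~R / h%:~R)
    (fun z => f z * (h%:~R * z - k%:~R) ^+ w).

Definition Qmap (w : nat) (f : C -> C) : rat -> C := Psi w (alpha w f).

(* T_n^oo, given by its formula on all functions on Q; for n > 0, a = n / d. *)
Definition hecke_inf (w n : nat) (g : rat -> C) (x : rat) : C :=
  \sum_(d <- divisors n) d%:R ^+ w *
    \sum_(b < d) g (((n %/ d)%:R * x + b%:R) / d%:R).

Lemma Psi_frac w E (h k : int) : dedekind_symbol w E -> 0 < h ->
  Psi w E (k%:~R / h%:~R) = h%:~R ^- w * E h k.
Proof.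
move=> [_ EM]; rewrite /Psi.
case: (divqP k h) => [_|c x c0]; first by rewrite ltxx.
move=> h0; have cp : 0 < c by move: h0; rewrite pmulr_lgt0 ?denq_gt0.
rewrite EM ?denq_gt0// intrM exprMn invfM mulrACA.
by rewrite mulVf ?mul1r// expf_neq0// intr_eq0.
Qed.

End Defs.

(* Main.v *)
(* For x rational, Q(f)(x) = int_0^oo f(x + i t) (i t)^w i dt, because
   h z - k = h i t on the line z = k/h + i t.  Substituting t -> (a/d) t in the
   (a, b, d) term of T_n f turns its integral into n^{w+1} d^{-(w+2)}
   (d/a)^{w+1} Q(f)((a x + b)/d), and the coefficient is d^w as n = a d.
   Exchanging the finite sum with the integral requires absolute convergence:
   the q-expansion makes f decay like e^{-2 pi t} as t -> oo, and modularity
   transports this decay to the rational cusp x as t -> 0. *)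

Require Import Defs.
From mathcomp Require Import all_boot all_order all_algebra.
From mathcomp Require Import complex.
From mathcomp Require Import all_classical all_reals all_analysis.
From mathcomp Require Import measurable_realfun.
From mathcomp Require Import ring lra.

Set Implicit Arguments.
Unset Strict Implicit.
Unset Printing Implicit Defensive.

Import Order.TTheory GRing.Theory Num.Theory.
Import numFieldNormedType.Exports.
Import Normc.

Local Open Scope classical_set_scope.
Local Open Scope ring_scope.
Local Open Scope complex_scope.

(** * Complex-valued Lebesgue integrals: linearity, scaling and domination *)

Section ComplexIntegral.
Context {R : realType}.
Local Notation mu := (@lebesgue_measure R).
Local Notation Re := complex.Re.
Local Notation Im := complex.Im.
Local Notation C := R[i]^o.
Implicit Types (D : set R) (g : R -> C).

(** Lebesgue measure is c times its pushforward under t -> c t: by uniqueness it is enough to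
    compare the two on half-open intervals, where the preimage of ]a, b] is ]a/c, b/c]. *)
Lemma ge0_integral_scale (c : R) (f : R -> \bar R) : 0 < c ->
  measurable_fun (`]0, +oo[ : set R) f -> (forall t, 0 <= f t)%E ->
  (\int[mu]_(t in `]0%R, +oo[) f t =
   c%:E * \int[mu]_(t in `]0%R, +oo[) f (c * t)%R)%E.
Proof.
move=> c0 mf f0.
have mc : measurable_fun [set: measurableTypeR R]
    ( *%R c : R -> measurableTypeR R).
  exact: mulrl_measurable.
pose k : {nonneg R} := NngNum (ltW c0).
have muE A : measurable A ->
    mu A = mscale k (pushforward mu ( *%R c : R -> measurableTypeR R)) A.
  apply: lebesgue_measure_unique => _ [[a b]] _ <-.
  change (mu `]a, b]%classic = c%:E * mu ( *%R c @^-1` `]a, b]%classic))%E.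
  rewrite (_ : _ @^-1` _ = `](c^-1 * a), (c^-1 * b)]%classic); last first.
    apply/seteqP; split => x /=; rewrite !in_itv/= [_ * a]mulrC [_ * b]mulrC;
      by rewrite ltr_pdivrMr// ler_pdivlMr// ![_ * c]mulrC.
  rewrite !lebesgue_measure_itv/= !lte_fin ltr_pM2l ?invr_gt0//.
  case: ifPn => _; last by rewrite mule0.
  by rewrite -!EFinB -EFinM -mulrBr mulrA divff ?gt_eqF// mul1r.
have pre : *%R c @^-1` `]0%R, +oo[%classic = `]0%R, +oo[%classic :> set R.
  by apply/seteqP; split => x /=; rewrite !in_itv/= !andbT pmulr_rgt0.
(* The half-line is its own preimage under t -> c t, so the right-hand integral can be read as one
   against the pushforward measure. *)
rewrite -[X in (_ = _ * integral _ X _)%E]pre -(ge0_integral_pushforward mc)//.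
rewrite -[c%:E]/(k%:num%:E) -ge0_integral_mscale//.
by apply: eq_measure_integral => A mA _; exact: muE.
Qed.

Lemma Rintegral_scale (c : R) (f : R -> R) : 0 < c ->
  measurable_fun (`]0, +oo[ : set R) f ->
  \int[mu]_(t in `]0, +oo[) f t = c * \int[mu]_(t in `]0, +oo[) f (c * t).
Proof.
move=> c0 mf; rewrite /Rintegral [in LHS]integralE [in RHS]integralE.
have mEf : measurable_fun (`]0, +oo[ : set R) (EFin \o f).
  exact/measurable_EFinP.
rewrite (ge0_integral_scale c0)//; last exact: measurable_funepos.
rewrite [X in (_ - X)%E](ge0_integral_scale c0)//; last first.
  exact: measurable_funeneg.
set A := (\int[mu]_(t in _) (EFin \o f)^\+ (c * t)%R)%E.
set B := (\int[mu]_(t in _) (EFin \o f)^\- (c * t)%R)%E.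
transitivity (c * fine (A - B)%E); last first.
  rewrite /A /B; congr (_ * fine (_ - _)%E);
    by apply: eq_integral => t _; rewrite !(funeposE, funenegE).
have A0 : (0 <= A)%E by apply: integral_ge0.
have B0 : (0 <= B)%E by apply: integral_ge0.
(* When A or B is infinite, A - B and c A - c B are infinite too, and [fine] sends both to 0. *)
case: A B A0 B0 => [a| |] [b| |] // _ _.
- by rewrite /= mulrBr.
- by rewrite gt0_muley ?lte_fin//= mulr0.
- by rewrite gt0_muley ?lte_fin//= mulr0.
- by rewrite gt0_muley ?lte_fin//= mulr0.
Qed.

(* [lebesgue_measure] lives on [measurableTypeR R], not on the Borel structure
   of [R] itself, hence the casts in the measurability hypotheses. *)
Definition Cintegrable D g :=
  mu.-integrable D (EFin \o (fun t => Re (g t))) /\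
  mu.-integrable D (EFin \o (fun t => Im (g t))).

Lemma Cintegrable0 D :
  measurable (D : set (measurableTypeR R)) -> Cintegrable D (fun=> 0).
Proof. by move=> mD; split; exact: integrable0. Qed.

Lemma CintegrableD D g h : measurable (D : set (measurableTypeR R)) ->
  Cintegrable D g ->
  Cintegrable D h -> Cintegrable D (fun t => g t + h t).
Proof.
move=> mD [g1 g2] [h1 h2]; split.
- apply: (eq_integrable mD _ _ _ (integrableD mD g1 h1)) => // t _ /=.
  by case: (g t) (h t) => [? ?] [? ?].
- apply: (eq_integrable mD _ _ _ (integrableD mD g2 h2)) => // t _ /=.
  by case: (g t) (h t) => [? ?] [? ?].
Qed.

Lemma CintegrableZ D g (c : C) :
  measurable (D : set (measurableTypeR R)) -> Cintegrable D g ->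
  Cintegrable D (fun t => c * g t).
Proof.
move=> mD [g1 g2]; split.
- apply: (eq_integrable mD _ _ _ (integrableB mD (integrableZl mD (Re c) g1)
    (integrableZl mD (Im c) g2))) => // t _ /=.
  by case: (g t) c => [? ?] [? ?].
- apply: (eq_integrable mD _ _ _ (integrableD mD (integrableZl mD (Re c) g2)
    (integrableZl mD (Im c) g1))) => // t _ /=.
  by case: (g t) c => [? ?] [? ?].
Qed.

Lemma CintegralD D g h : measurable (D : set (measurableTypeR R)) ->
  Cintegrable D g ->
  Cintegrable D h ->
  Cintegral D (fun t => g t + h t) = Cintegral D g + Cintegral D h.
Proof.
move=> mD [g1 g2] [h1 h2]; apply/eqP; rewrite eq_complex/= -!RintegralD//.
by apply/andP; split; apply/eqP; apply: eq_Rintegral => t _;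
  case: (g t) (h t) => [? ?] [? ?].
Qed.

Lemma CintegralZ D g (c : C) :
  measurable (D : set (measurableTypeR R)) -> Cintegrable D g ->
  Cintegral D (fun t => c * g t) = c * Cintegral D g.
Proof.
move=> mD [g1 g2]; case: c => a b; apply/eqP; rewrite eq_complex/=.
have i1 r : mu.-integrable D (EFin \o (fun t => r * Re (g t))).
  exact: (integrableZl mD r g1).
have i2 r : mu.-integrable D (EFin \o (fun t => r * Im (g t))).
  exact: (integrableZl mD r g2).
rewrite -!RintegralZl// -RintegralD// -RintegralB//.
by apply/andP; split; apply/eqP; apply: eq_Rintegral => t _;
  case: (g t) => [? ?].
Qed.

Lemma Cintegrable_sum D (I : Type) (s : seq I) (P : pred I) (g : I -> R -> C) :
  measurable (D : set (measurableTypeR R)) ->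
  (forall i, P i -> Cintegrable D (g i)) ->
  Cintegrable D (fun t => \sum_(i <- s | P i) g i t).
Proof.
move=> mD gi; elim: s => [|i s ih].
  by under eq_fun do rewrite big_nil; exact: Cintegrable0.
under eq_fun do rewrite big_cons.
by case: (boolP (P i)) => // Pi; apply: CintegrableD => //; exact: gi.
Qed.

Lemma Cintegral_sum D (I : Type) (s : seq I) (P : pred I) (g : I -> R -> C) :
  measurable (D : set (measurableTypeR R)) ->
  (forall i, P i -> Cintegrable D (g i)) ->
  Cintegral D (fun t => \sum_(i <- s | P i) g i t) =
  \sum_(i <- s | P i) Cintegral D (g i).
Proof.
move=> mD gi; elim: s => [|i s ih].
  under eq_fun do rewrite big_nil.
  by rewrite big_nil /Cintegral !Rintegral_cst// !mul0r.
under eq_fun do rewrite big_cons.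
rewrite big_cons -ih; case: (boolP (P i)) => // Pi; rewrite CintegralD//.
  exact: gi.
exact: Cintegrable_sum.
Qed.

(** The integral of |f(t)| is c times that of |f(c t)|, so the latter cannot be infinite. *)
Lemma integrable_scale (c : R) (f : R -> R) : 0 < c ->
  mu.-integrable `]0, +oo[ (EFin \o f) ->
  mu.-integrable `]0, +oo[ (EFin \o (fun t => f (c * t))).
Proof.
move=> c0 /integrableP[mf foo]; apply/integrableP; split.
  have mc : measurable_fun (`]0, +oo[ : set (measurableTypeR R))
      ( *%R c : R -> measurableTypeR R) by exact: mulrl_measurable.
  apply: (measurable_comp _ _ mf mc); first exact: measurable_itv.
  by move=> _ [t + <-]; rewrite /= !in_itv/= !andbT => t0; exact: mulr_gt0.
have := ge0_integral_scale c0 (f := fun t => `|(f t)%:E|%E).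
move=> H; move: foo; rewrite H//; last first.
  exact: measurableT_comp.
move=> h; rewrite ltey; apply/eqP => E; move: h.
by rewrite /= in E; rewrite E gt0_muley ?lte_fin// ltxx.
Qed.

Lemma Cintegral_scale g (c : R) : 0 < c -> Cintegrable `]0, +oo[ g ->
  Cintegral `]0, +oo[ g = c%:C * Cintegral `]0, +oo[ (fun t => g (c * t)).
Proof.
move=> c0 [/integrableP[/measurable_EFinP mg1 _]].
move=> /integrableP[/measurable_EFinP mg2 _].
rewrite /Cintegral (Rintegral_scale c0)//.
rewrite [in X in _ +i* X](Rintegral_scale c0)//.
by apply/eqP; rewrite eq_complex/= !mul0r subr0 addr0 !eqxx.
Qed.

Lemma Cintegrable_scale g (c : R) : 0 < c -> Cintegrable `]0, +oo[ g ->
  Cintegrable `]0, +oo[ (fun t => g (c * t)).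
Proof.
by move=> c0 [g1 g2]; split;
  [exact: (integrable_scale c0 g1)|exact: (integrable_scale c0 g2)].
Qed.

Lemma Re_le_normc (z : R[i]) : `|Re z| <= normc z.
Proof.
case: z => a b /=; rewrite -sqrtr_sqr ler_wsqrtr// lerDl; exact: sqr_ge0.
Qed.

Lemma Im_le_normc (z : R[i]) : `|Im z| <= normc z.
Proof.
case: z => a b /=; rewrite -sqrtr_sqr ler_wsqrtr// lerDr; exact: sqr_ge0.
Qed.

(** The dominating function is M times the density of the exponential law of rate 1, which is e^(-t)
    for t >= 0; it bounds both components through the norm. *)
Lemma dominated_Cintegrable g (M : R) :
  measurable_fun (`]0, +oo[ : set R) (fun t => Re (g t)) ->
  measurable_fun (`]0, +oo[ : set R) (fun t => Im (g t)) ->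
  (forall t, 0 < t -> normc (g t) <= M * expR (- t)) ->
  Cintegrable `]0, +oo[ g.
Proof.
move=> m1 m2 gM.
have mD : measurable (`]0, +oo[ : set (measurableTypeR R)).
  exact: measurable_itv.
have iE : mu.-integrable `]0, +oo[ (fun t => (M * exponential_pdf 1 t)%:E).
  apply: (integrableZl mD M (f := EFin \o exponential_pdf 1)).
  apply: (@integrableS _ _ _ _ setT) => //.
  exact: integrable_exponential_pdf.
have MM t : 0 < t -> M * expR (-t) <= `|M * exponential_pdf 1 t|.
  move=> t0; rewrite (exponential_pdfE _ (ltW t0)) mul1r mulN1r.
  exact: ler_norm.
split; apply: (le_integrable mD _ _ iE) => //=.
- exact/measurable_EFinP.
- move=> t; rewrite in_itv/= andbT => t0; rewrite lee_fin.
  by rewrite (le_trans (Re_le_normc _))// (le_trans (gM _ t0))// MM.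
- exact/measurable_EFinP.
- move=> t; rewrite in_itv/= andbT => t0; rewrite lee_fin.
  by rewrite (le_trans (Im_le_normc _))// (le_trans (gM _ t0))// MM.
Qed.

End ComplexIntegral.

(** * Norm bounds and the decay of cusp forms at infinity *)

Section QExpansion.
Context {R : realType}.
Local Notation Re := complex.Re.
Local Notation Im := complex.Im.
Local Notation C := R[i]^o.

Lemma normcX (z : R[i]) n : normc (z ^+ n) = normc z ^+ n.
Proof. by elim: n => [|n ih]; rewrite ?expr0 ?normc1// !exprS normcM ih. Qed.

Lemma normc_real (x : R) : normc x%:C = `|x|.
Proof. by rewrite /= expr0n/= addr0 sqrtr_sqr. Qed.

Lemma normc_ge0 (z : R[i]) : 0 <= normc z.
Proof. by case: z => a b; exact: sqrtr_ge0. Qed.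

Lemma normc_sum (I : Type) (s : seq I) (P : pred I) (g : I -> R[i]) :
  normc (\sum_(i <- s | P i) g i) <= \sum_(i <- s | P i) normc (g i).
Proof.
apply: (big_ind2 (fun x y => normc x <= y)) => [|x1 x2 y1 y2 h1 h2|//].
  by rewrite normc0.
by rewrite (le_trans (le_normcD _ _))// lerD.
Qed.

Lemma normc_qparam (z : C) : normc (qparam z) = expR (- (2 * pi * Im z)).
Proof.
rewrite /qparam /cexp /=.
rewrite !exprMn -mulrDr cos2Dsin2 mulr1 sqrtr_sqr ger0_norm ?expR_ge0//.
congr expR; case: z => x y /=; ring.
Qed.

(** A term is the difference of two consecutive partial sums. From N on both lie within 1 of the
    limit, whence the 2; the finitely many earlier terms are bounded by the sum of their norms. *)
Lemma bounded_terms (s : nat -> C) (l : C) :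
  (fun N => \sum_(0 <= m < N) s m) @ \oo --> l ->
  exists2 M, 0 <= M & forall m, normc (s m) <= M.
Proof.
move=> /cvgrPdist_lt/(_ 1 ltr01)[N _ NP].
have {}NP n : (N <= n)%N -> normc (l - \sum_(0 <= m < n) s m) < 1.
  by move=> /NP; rewrite ltcE => /andP[_].
exists (2 + \sum_(0 <= m < N) normc (s m)).
  by rewrite addr_ge0// sumr_ge0// => i _; exact: normc_ge0.
move=> m; have [mN|Nm] := ltnP m N.
  rewrite (big_rem m) ?mem_index_iota//= addrCA lerDl addr_ge0//.
  by rewrite sumr_ge0// => i _; exact: normc_ge0.
rewrite ler_wpDr//; first by rewrite sumr_ge0// => i _; exact: normc_ge0.
have -> : s m = (l - \sum_(0 <= k < m) s k) - (l - \sum_(0 <= k < m.+1) s k).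
  by rewrite big_nat_recr//=; ring.
rewrite (le_trans (le_normcD _ _))// normcN.
by have := NP _ Nm; have := NP _ (leqW Nm); lra.
Qed.

Lemma le_normc_lim (u : nat -> C) (l : C) (B : R) :
  u @ \oo --> l -> (forall n, normc (u n) <= B) -> normc l <= B.
Proof.
move=> /cvgrPdist_lt ul uB; apply/ler_addgt0Pr => e e0.
have /ul[N _ /(_ N (leqnn N))] : 0 < e%:C by rewrite ltcR.
rewrite ltcE => /andP[_ /= le].
have -> : l = (l - u N) + u N by rewrite subrK.
by rewrite (le_trans (le_normcD _ _))// addrC lerD// ltW.
Qed.

(* Convergence at height y/2 bounds the coefficients geometrically, and the
   vanishing constant term leaves a factor q. *)
Lemma cusp_form_decay wt (f : C -> C) (y : R) : cusp_form wt f -> 0 < y ->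
  exists2 K, 0 <= K &
    forall z, y <= Im z -> normc (f z) <= K * expR (- (2 * pi * Im z)).
Proof.
move=> [_ _ [a a0 fa]] y0.
have pi0 := @pi_gt0 R.
pose z0 : C := 0 +i* (y / 2).
have /fa/bounded_terms[M M0 aM] : upper_half z0.
  by rewrite /upper_half/= divr_gt0.
(* This is |q| at z0, so that |a m| <= M / r^m. *)
pose r : R := expR (- (pi * y)).
have r1 : r < 1 by rewrite /r expR_lt1 oppr_lt0 mulr_gt0.
have r0 : 0 < r by exact: expR_gt0.
(* With x = |q(z)| / r, the terms from m = 1 on add up to at most M x / (1 - x), and x <= r bounds
   this by M x / (1 - r), which is the constant times |q(z)|. *)
exists (M / r / (1 - r)); first by rewrite !divr_ge0// ?ltW// subr_gt0.
move=> z yz; have z_up : upper_half z by exact: lt_le_trans yz.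
apply: (le_normc_lim (fa z z_up)) => N.
pose x := expR (- (2 * pi * Im z)) / r.
have x0 : 0 < x by rewrite divr_gt0 ?expR_gt0.
(* Since Im z >= y, |q(z)| <= e^(-2 pi y) = r^2. *)
have xr : x <= r.
  rewrite /x /r -expRN -expRD ler_expR opprK.
  have : pi * y <= pi * Im z by rewrite ler_pM2l.
  lra.
have le1 m : normc (a m * qparam z ^+ m) <= if m is 0%N then 0 else M * x ^+ m.
  case: m => [|m]; first by rewrite a0 mul0r normc0.
  have := aM m.+1; rewrite !normcM !normcX !normc_qparam /=.
  rewrite (_ : expR (- (2 * pi * (y / 2))) = r); last by congr expR; field.
  move=> h; rewrite /x expr_div_n [leRHS]mulrA [leRHS]mulrAC.
  by rewrite ler_wpM2r ?exprn_ge0 ?expR_ge0// ler_pdivlMr ?exprn_gt0.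
rewrite (le_trans (normc_sum _ _ _))//.
apply: (@le_trans _ _ (\sum_(0 <= m < N) if m is 0%N then 0 else M * x ^+ m)).
  by apply: ler_sum => i _; exact: le1.
case: N => [|N].
  rewrite big_nil mulr_ge0 ?expR_ge0// !divr_ge0// ?ltW//.
  by rewrite subr_gt0.
(* The zero term drops out, leaving a geometric sum with first term M x. *)
rewrite big_nat_recl// add0r.
have := @geometric_le_lim R N (M * x) x (mulr_ge0 M0 (ltW x0)) x0.
rewrite (ger0_norm (ltW x0)) => /(_ (le_lt_trans xr r1)).
rewrite /series/= => h.
apply: (@le_trans _ _ (M * x / (1 - x))).
  by apply: le_trans h; rewrite le_eqVlt; apply/orP; left; apply/eqP;
    apply: eq_bigr => i _; rewrite exprS mulrA.
have -> : M / r / (1 - r) * expR (- (2 * pi * Im z)) = M * x / (1 - r).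
  by rewrite /x -[in RHS]mulrA -!mulrA; congr (_ * _); rewrite mulrA [LHS]mulrC.
apply: ler_wpM2l; first by rewrite mulr_ge0// ltW.
by rewrite lef_pV2 ?posrE ?subr_gt0 ?(le_lt_trans xr r1)// lerD2l lerN2.
Qed.

End QExpansion.

(** * Integrability along vertical lines ending at a rational cusp *)

Section Integrability.
Context {R : realType}.
Local Notation Re := complex.Re.
Local Notation Im := complex.Im.
Local Notation C := R[i]^o.

(** On z = x + i t with x = k/h, the factor (h z - k)^w is h^w (i t)^w; this is the contour
    integrand, with dz = i dt included, after division by h^w. *)
Definition mellin (w : nat) (f : C -> C) (x t : R) : C :=
  f (x +i* t) * (0 +i* t) ^+ w * 'i%C.

Lemma normc_mellin w f x t : 0 < t ->
  normc (mellin w f x t) = normc (f (x +i* t)) * t ^+ w.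
Proof.
move=> t0; rewrite /mellin !normcM normcX /=.
rewrite !expr0n/= !add0r expr1n sqrtr1 mulr1.
by rewrite sqrtr_sqr (gtr0_norm t0).
Qed.

(** Absorbs powers of t into the decay: one term of the exponential series gives t^n <= n! e^t, and
    pi >= 2 leaves at most e^(-t). *)
Lemma exprn_expR_le n (t : R) : 0 <= t ->
  t ^+ n * expR (- (2 * pi * t)) <= n`!%:R * expR (- t).
Proof.
move=> t0; have h : t ^+ n <= n`!%:R * expR t.
  case: n => [|n].
    by rewrite expr0 fact0 mul1r (le_trans _ (expR_ge1Dx t))// lerDl.
  rewrite mulrC -ler_pdivrMr ?ltr0n ?fact_gt0//.
  by apply: le_trans (expR_ge1Dxn n t0); rewrite lerDr.
apply: le_trans (ler_wpM2r (expR_ge0 _) h) _.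
rewrite -[leLHS]mulrA ler_wpM2l// -expRD ler_expR.
have : 2 * t <= pi * t by rewrite ler_wpM2r// pi_ge2.
by lra.
Qed.

Lemma vertical_continuous (f : C -> C) (x t : R) :
  {for (x +i* t : C), continuous f} ->
  forall e, 0 < e -> \forall s \near t, normc (f (x +i* t) - f (x +i* s)) < e.
Proof.
move=> /cvgrPdist_lt fc e e0.
have /fc/nbhs_ballP[r /= r0 rf] : 0 < e%:C by rewrite ltcR.
(* The order on C only compares numbers with equal imaginary parts, so a positive radius is real. *)
move: r0; rewrite ltcE/= => /andP[/eqP ri r0].
near=> s.
have : ball (x +i* t : C) r (x +i* s).
  rewrite -ball_normE/= ltcE/= -ri eqxx/= subrr expr0n/= add0r sqrtr_sqr.
  by near: s; exact: (nbhsx_ballx t _ r0).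
by move/rf; rewrite ltcE => /andP[_].
Unshelve. all: by end_near. Qed.

(** Complex differentiability makes f continuous, hence both components are continuous in t on the
    open half-line, and so measurable there. *)
Lemma vertical_measurable (f : C -> C) (x : R) :
  (forall z, upper_half z -> derivable f z 1) ->
  measurable_fun (`]0, +oo[ : set R) (fun t => Re (f (x +i* t))) /\
  measurable_fun (`]0, +oo[ : set R) (fun t => Im (f (x +i* t))).
Proof.
move=> df; have fc t : 0 < t -> {for (x +i* t : C), continuous f}.
  by move=> t0; apply/differentiable_continuous/derivable1_diffP/df.
split; apply: open_continuous_measurable_fun; try exact: interval_open.
- move=> t; rewrite inE/= in_itv/= andbT => t0; apply/cvgrPdist_lt => e e0.
  near=> s; have : normc (f (x +i* t) - f (x +i* s)) < e.
    by near: s; exact: vertical_continuous (fc t t0) _ e0.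
  by apply: le_lt_trans; have := Re_le_normc (f (x +i* t) - f (x +i* s));
    case: (f _) (f _) => [? ?] [? ?].
- move=> t; rewrite inE/= in_itv/= andbT => t0; apply/cvgrPdist_lt => e e0.
  near=> s; have : normc (f (x +i* t) - f (x +i* s)) < e.
    by near: s; exact: vertical_continuous (fc t t0) _ e0.
  by apply: le_lt_trans; have := Im_le_normc (f (x +i* t) - f (x +i* s));
    case: (f _) (f _) => [? ?] [? ?].
Unshelve. all: by end_near. Qed.

(* A matrix of SL_2(Z) sending the cusp x to infinity maps x + i t to height
   1 / (q^2 t), where q is the denominator of x. *)
Lemma cusp_form_at_cusp wt (f : C -> C) (x : rat) : cusp_form wt f ->
  exists y : R, forall t : R, 0 < t ->
   normc (f (ratr x +i* t)) * ((denq x)%:~R * t) ^+ wt =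
   normc (f (y +i* ((denq x)%:~R ^+ 2 * t)^-1)).
Proof.
move=> [_ fmod _].
(* Bezout for p = [numq x] and q = [denq x]: u p + v q = 1 says that the matrix with rows (-u, -v)
   and (q, -p) has determinant 1. *)
have [[u v] uv] : exists uv : int * int, uv.1 * numq x + uv.2 * denq x = 1.
  have := coprime_num_den x.
  by rewrite -[coprime _ _]/(coprimez _ _) => /coprimezP[uv h]; exists uv.
have q0 : (denq x)%:~R != 0 :> R by rewrite intr_eq0 denq_neq0.
have q0' : (denq x)%:~R != 0 :> R[i] by rewrite intr_eq0 denq_neq0.
(* The matrix sends x to infinity, so the vertical line above x goes to a vertical line, the one
   above the image -u/q of infinity. *)
exists ((- u)%:~R / (denq x)%:~R) => t t0.
pose z : C := ratr x +i* t.
have t0' : t != 0 by rewrite gt_eqF.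
have den : (denq x)%:~R * z + (- numq x)%:~R = 0 +i* ((denq x)%:~R * t).
  have -> : (denq x)%:~R = ((denq x)%:~R : R)%:C by rewrite rmorph_int.
  have -> : (- numq x)%:~R = ((- numq x)%:~R : R)%:C by rewrite rmorph_int.
  apply/eqP; rewrite eq_complex/= /ratr.
  apply/andP; split; apply/eqP; field => //.
have := fmod (- u) (- v) (denq x) (- numq x) z.
rewrite {}den => fz.
have -> : (- u)%:~R / (denq x)%:~R +i* ((denq x)%:~R ^+ 2 * t)^-1 =
    ((- u)%:~R * z + (- v)%:~R) / (0 +i* ((denq x)%:~R * t)) :> C.
  apply/esym/(canLR (mulfK _)).
    by rewrite eq_complex/= negb_and mulf_neq0// orbT.
  have -> : (- u)%:~R = ((- u)%:~R : R)%:C by rewrite rmorph_int.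
  have -> : (- v)%:~R = ((- v)%:~R : R)%:C by rewrite rmorph_int.
  have uvR : u%:~R * (numq x)%:~R + v%:~R * (denq x)%:~R = 1 :> R.
    by rewrite -!intrM -intrD uv.
  apply/eqP; rewrite eq_complex/= /ratr; apply/andP; split; apply/eqP.
  - have -> : (- v)%:~R = (u%:~R * (numq x)%:~R - 1) / (denq x)%:~R :> R.
      by apply: (canRL (mulfK q0)); move: uvR; rewrite mulrNz; lra.
    by field; rewrite q0 t0'.
  - by field; rewrite q0 t0'.
rewrite fz//; last by rewrite -uv; ring.
rewrite normcM normcX mulrC /= expr0n/= add0r sqrtr_sqr ger0_norm//.
by rewrite mulr_ge0 ?ler0z ?denq_ge0// ltW.
Qed.

(** Split at t = 1/q^2. Above it the decay of f applies directly; below it modularity moves the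
    point to height s = 1/(q^2 t), again at least 1/q^2, so one decay constant K serves both
    ranges. *)
Lemma mellin_integrable w (f : C -> C) (x : rat) : cusp_form (w + 2) f ->
  Cintegrable `]0, +oo[ (mellin w f (ratr x)).
Proof.
move=> hf; pose q : R := (denq x)%:~R.
have q1 : 1 <= q by rewrite ler1z -gtz0_ge1 denq_gt0.
have q0 : 0 < q by exact: lt_le_trans q1.
have y0 : 0 < (q ^+ 2)^-1 by rewrite invr_gt0 exprn_gt0.
have [K K0 fK] := cusp_form_decay hf y0.
have [y fy] := cusp_form_at_cusp x hf.
have [m1 m2] := @vertical_measurable f (ratr x) (let: And3 df _ _ := hf in df).
(* Isolates the real factor t^w and the constant i^(w+1), so that measurability reduces to that of
   the components of f. *)
have mellinE t : mellin w f (ratr x) t =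
    (t ^+ w)%:C * (('i%C ^+ w * 'i%C) * f (ratr x +i* t)).
  rewrite /mellin (_ : 0 +i* t = t%:C * 'i%C); last first.
    by apply/eqP; rewrite eq_complex/= !mul0r !mulr0 mulr1 subrr addr0 !eqxx.
  by rewrite exprMn rmorphXn/=; ring.
pose c : R[i] := 'i%C ^+ w * 'i%C.
(* K w! serves t >= 1/q^2. In the other summand 2 K bounds |f| s^2, q^4 comes from passing from t to
   s, and e makes up for e^(-t), as t <= 1. *)
apply: (@dominated_Cintegrable _ _ (K * w`!%:R + 2 * K * q ^+ 4 * expR 1)).
- rewrite (_ : (fun t => Re _) = fun t => t ^+ w *
      (Re c * Re (f (ratr x +i* t)) - Im c * Im (f (ratr x +i* t)))); last first.
    apply/funext => t; rewrite mellinE -/c; case: (f _) c => [? ?] [? ?] /=.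
    by rewrite mul0r subr0.
  apply: measurable_funM; first exact: measurable_funX.
  by apply: measurable_funB; apply: measurable_funM.
- rewrite (_ : (fun t => Im _) = fun t => t ^+ w *
      (Re c * Im (f (ratr x +i* t)) + Im c * Re (f (ratr x +i* t)))); last first.
    apply/funext => t; rewrite mellinE -/c; case: (f _) c => [? ?] [? ?] /=.
    by rewrite mul0r addr0.
  apply: measurable_funM; first exact: measurable_funX.
  by apply: measurable_funD; apply: measurable_funM.
move=> t t0; rewrite (normc_mellin _ _ _ t0) mulrDl.
have [tq|tq] := leP (q ^+ 2)^-1 t.
  apply: ler_wpDr; first by rewrite !mulr_ge0 ?exprn_ge0 ?expR_ge0// ltW.
  apply: (@le_trans _ _ (K * (t ^+ w * expR (- (2 * pi * t))))).
    rewrite [leRHS]mulrCA [leLHS]mulrC.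
    by apply: ler_wpM2l; [rewrite exprn_ge0// ltW|exact: fK].
  by rewrite -[leRHS]mulrA; apply: ler_wpM2l => //; exact/exprn_expR_le/ltW.
apply: ler_wpDl; first by rewrite !mulr_ge0 ?expR_ge0.
pose s := (q ^+ 2 * t)^-1.
have s0 : 0 < s by rewrite invr_gt0 mulr_gt0// exprn_gt0.
have sq : (q ^+ 2)^-1 <= s.
  rewrite lef_pV2 ?posrE ?mulr_gt0 ?exprn_gt0//.
  rewrite ger_pMr ?exprn_gt0// (le_trans (ltW tq))// invf_le1 ?exprn_gt0//.
  exact: exprn_ege1.
(* Modularity contributes (q t)^(-(w+2)); against t^w this leaves t^(-2), and 1/t = q^2 s turns it
   into q^4 s^2. *)
have -> : normc (f (ratr x +i* t)) * t ^+ w =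
    normc (f (y +i* s)) * s ^+ 2 * (q ^+ 4 / q ^+ (w + 2)).
  rewrite /s -fy// exprMn !exprD -/q.
  by field; rewrite !expf_neq0 ?gt_eqF.
have t1 : t <= 1.
  by rewrite (le_trans (ltW tq))// invf_le1 ?exprn_gt0// exprn_ege1.
have e1 : 1 <= expR 1 * expR (- t).
  by rewrite -expRD (le_trans _ (expR_ge1Dx _))// lerDl subr_ge0.
(* The 2 is 2!, from [exprn_expR_le] with exponent 2, and e^(-s) <= 1. *)
have fs : normc (f (y +i* s)) * s ^+ 2 <= 2 * K.
  apply: (@le_trans _ _ (K * (s ^+ 2 * expR (- (2 * pi * s))))).
    rewrite [leRHS]mulrCA [leLHS]mulrC.
    by apply: ler_wpM2l; [rewrite exprn_ge0// ltW|exact: fK].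
  rewrite [leLHS]mulrC; apply: ler_wpM2r => //.
  apply: le_trans (exprn_expR_le _ (ltW s0)) _.
  by rewrite ler_piMr// expR_le1 oppr_le0 ltW.
have qw : q ^+ 4 / q ^+ (w + 2) <= q ^+ 4.
  apply: ler_piMr; first by rewrite exprn_ge0// ltW.
  by rewrite invf_le1 ?exprn_gt0// exprn_ege1.
apply: (@le_trans _ _ (2 * K * q ^+ 4)).
  apply: ler_pM => //.
    by rewrite mulr_ge0 ?normc_ge0// exprn_ge0// ltW.
  by rewrite divr_ge0// exprn_ge0// ltW.
by rewrite -[leRHS]mulrA; apply: ler_peMr => //;
  rewrite !mulr_ge0 ?exprn_ge0 ?(ltW q0).
Qed.

End Integrability.

(** * Comparison of the two Hecke operators *)

Section Hecke.
Context {R : realType}.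
Local Notation C := R[i]^o.
Let half_line := (`]0, +oo[%classic : set (measurableTypeR R)).
Let mhalf : measurable half_line := measurable_itv _.

(** The factor h^w of the integrand leaves the integral by linearity and cancels the h^(-w) of
    [Psi]. *)
Lemma Qmap_mellin w (f : C -> C) (x : rat) :
  Cintegrable `]0, +oo[ (mellin w f (ratr x)) ->
  Qmap w f x = Cintegral `]0, +oo[ (mellin w f (ratr x)).
Proof.
move=> fi; have q0 : (denq x)%:~R != 0 :> R by rewrite intr_eq0 denq_neq0.
rewrite /Qmap /Psi /alpha /vertical_integral.
rewrite (_ : (fun t => _) = fun t => (denq x)%:~R ^+ w * mellin w f (ratr x) t).
  by rewrite CintegralZ// mulKf// expf_neq0// intr_eq0 denq_neq0.
apply/funext => t; rewrite /mellin /ratr.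
rewrite (_ : _ - _ = (denq x)%:~R * (0 +i* t)); last first.
  rewrite -(rmorph_int (real_complex R) (denq x)).
  rewrite -(rmorph_int (real_complex R) (numq x)).
  by apply/eqP; rewrite eq_complex/=; apply/andP; split; apply/eqP; field.
by rewrite exprMn; ring.
Qed.

(** The map z -> (a z + b)/d carries the vertical line above x to the one above (a x + b)/d and
    scales heights by a/d; (d/a)^w undoes this scaling in the factor t^w. *)
Lemma mellin_affine w (f : C -> C) (a d b : nat) (x t : R) :
  (0 < a)%N -> (0 < d)%N ->
  f ((a%:R * (x +i* t) + b%:R) / d%:R) * (0 +i* t) ^+ w * 'i%C =
  (d%:R / a%:R) ^+ w *
    mellin w f ((a%:R * x + b%:R) / d%:R) (a%:R / d%:R * t).
Proof.
move=> a0 d0; have aR : a%:R != 0 :> R by rewrite pnatr_eq0 -lt0n.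
have dR : d%:R != 0 :> R by rewrite pnatr_eq0 -lt0n.
rewrite -!(rmorph_nat (real_complex R)) /mellin.
have -> : (a%:R%:C * (x +i* t) + b%:R%:C) / d%:R%:C =
    ((a%:R * x + b%:R) / d%:R) +i* (a%:R / d%:R * t).
  rewrite -fmorphV.
  by apply/eqP; rewrite eq_complex/=; apply/andP; split; apply/eqP; field.
have -> : 0 +i* (a%:R / d%:R * t) = (a%:R / d%:R)%:C * (0 +i* t).
  by apply/eqP; rewrite eq_complex/=; apply/andP; split; apply/eqP; ring.
rewrite -fmorphV -rmorphM/= exprMn.
set F := f _; set I := (0 +i* t) ^+ w.
have : (d%:R / a%:R)%:C ^+ w * (a%:R / d%:R)%:C ^+ w = 1 :> R[i].
  by rewrite -exprMn -rmorphM/= mulrA divfK// divff// expr1n.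
set A := _ ^+ w; set B := _ ^+ w => AB.
by rewrite -[F in LHS]mul1r -AB; ring.
Qed.

Lemma Qmap_hecke w n (f : C -> C) (x : rat) : (0 < n)%N ->
  cusp_form (w + 2) f -> Qmap w (hecke w n f) x = hecke_inf w n (Qmap w f) x.
Proof.
move=> n0 hf.
pose y d b : rat := ((n %/ d)%:R * x + b%:R) / d%:R.
pose c d : R := (n %/ d)%:R / d%:R.
(* The coefficient in T_n times the (d/a)^w of [mellin_affine]; the Jacobian a/d enters only at the
   end. *)
pose k d : C := n%:R ^+ w.+1 * d%:R ^- (w + 2) * (d%:R / (n %/ d)%:R) ^+ w.
have ratr_y d b : ratr (y d b) = ((n %/ d)%:R * ratr x + b%:R) / d%:R :> R.
  by rewrite fmorph_div rmorphD rmorphM !rmorph_nat.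
have dn d : d \in divisors n -> (0 < d)%N /\ (0 < n %/ d)%N.
  rewrite -dvdn_divisors// => d_n; have d0 := dvdn_gt0 n0 d_n.
  by split=> //; rewrite divn_gt0// dvdn_leq.
have c0 d : d \in divisors n -> 0 < c d.
  by move=> /dn[? ?]; rewrite divr_gt0// ltr0n.
(* The sum carries the condition that d divides n, which supplies the positivity of a/d needed for
   integrability of each term. *)
have mellinE : mellin w (hecke w n f) (ratr x) = fun t =>
    \sum_(d <- divisors n | d \in divisors n)
      k d * \sum_(b < d) mellin w f (ratr (y d b)) (c d * t).
  apply/funext => t; rewrite {1}/mellin /hecke -mulrA mulr_sumr mulr_suml big_seq.
  apply: eq_bigr => d /dn[d0 a0]; rewrite /k -!mulrA; congr (_ * (_ * _)).
  rewrite mulr_suml mulr_sumr; apply: eq_bigr => b _.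
  rewrite mulrA (mellin_affine _ _ _ _ _ a0 d0) ratr_y.
  by congr (_ * mellin _ _ _ _); rewrite mulrA.
have int_term d b : d \in divisors n ->
    Cintegrable `]0, +oo[ (fun t => mellin w f (ratr (y d b)) (c d * t)).
  by move=> /c0 cd; apply: Cintegrable_scale => //; exact: mellin_integrable.
have int_sum d : d \in divisors n -> Cintegrable `]0, +oo[
    (fun t => \sum_(b < d) mellin w f (ratr (y d b)) (c d * t)).
  by move=> dd; apply: Cintegrable_sum => // b _; exact: int_term.
have int_hecke d : d \in divisors n -> Cintegrable `]0, +oo[
    (fun t => k d * \sum_(b < d) mellin w f (ratr (y d b)) (c d * t)).
  by move=> dd; apply: CintegrableZ => //; exact: int_sum.
rewrite Qmap_mellin mellinE; last exact: Cintegrable_sum.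
rewrite Cintegral_sum// /hecke_inf [RHS]big_seq.
apply: eq_bigr => d dd; rewrite CintegralZ//; last exact: int_sum.
rewrite Cintegral_sum//; last by move=> b _; exact: int_term.
rewrite !mulr_sumr; apply: eq_bigr => b _.
rewrite -/(y d b) Qmap_mellin; last exact: mellin_integrable.
rewrite [in RHS](Cintegral_scale (c0 d dd)); last exact: mellin_integrable.
(* Scaling on the right has brought out the Jacobian a/d, so what remains is k d = d^w (a/d), which
   n = a d gives. *)
rewrite mulrA; congr (_ * _).
have [d0 a0] := dn d dd.
have aR : (n %/ d)%:R != 0 :> R[i] by rewrite pnatr_eq0 -lt0n.
have dR : d%:R != 0 :> R[i] by rewrite pnatr_eq0 -lt0n.
rewrite /k /c rmorphM/= fmorphV !rmorph_nat.
have -> : n%:R = (n %/ d)%:R * d%:R :> C.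
  by rewrite -natrM divnK// dvdn_divisors.
rewrite !(exprMn, exprVn, exprS, exprD).
by field; rewrite dR !expf_neq0.
Qed.

End Hecke.

Theorem corollary4p1 (R : realType) (w n : nat)
  (w_gt0 : (0 < w)%N) (w_even : ~~ odd w) (n_gt0 : (0 < n)%N)
  (f : R[i]^o -> R[i]^o) (hf : cusp_form (w + 2)%N f) :
  Qmap w (hecke w n f) = hecke_inf w n (Qmap w f).
Proof. by apply/funext => x; exact: Qmap_hecke. Qed.
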